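(* Let $\alpha_i\ge 0$, $\beta_i>0$ ($1\le i\le 5$) and $Q>0$ be real numbers, and consider the networks $N$ and $N^+$ with these parameters and total flow $Q$. Suppose that at equilibria both $N$ and $N^+$ have no paths with vanishing flow. Then Braess' paradox occurs in $N/N^+$ (i.e. $T^+_{Eq}>T_{Eq}$) if and only if $\mathcal B_1>0$ and $$\max\left\{\frac{\alpha}{\beta_{12}},\ \frac{-\alpha}{\beta_{45}},\ \mu_1,\ \mu_2\right\} < Q < \frac{\hat\alpha\beta_{14}+\bar\alpha\beta_{25}}{\mathcal B_1}.$$
   Context: The network $N^+$ has nodes $a,b,c,d$ and directed links $(a,b),(b,d),(b,c),(a,c),(c,d)$ with travel times $\alpha_1+\beta_1f_{ab}$, $\alpha_2+\beta_2f_{bd}$, $\alpha_3+\beta_3f_{bc}$, $\alpha_4+\beta_4f_{ac}$, $\alpha_5+\beta_5f_{cd}$ respectively, where $f_{ij}\ge 0$ is the (real) flow on link $(i,j)$ and $\alpha_i\ge 0$, $\beta_i>0$. All traffic, of total amount $Q>0$ (real), goes from $a$ to $d$ along the paths $P_1=a-b-d$, $P_2=a-c-d$, $P_3=a-b-c-d$. The network $N$ is $N^+$ with the link $(b,c)$ removed, so its paths are $P_1,P_2$ only. A flow assigns a non-negative real amount to each path, with total $Q$; the flow on a link is the sum of the flows of the paths containing it; the travel time on a path is the sum of the travel times of its links. A path has vanishing flow if its path flow is $0$, and non-vanishing flow otherwise. A network is at equilibrium if all paths with non-vanishing flow have the same travel time, and every path with vanishing flow has travel time at least this common value. The equilibrium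 exists and is unique; its common travel time is denoted $T_{Eq}$ for $N$ and $T^+_{Eq}$ for $N^+$. Braess' paradox is said to occur in $N/N^+$ for the total flow $Q$ if $T^+_{Eq}>T_{Eq}$. Notation: multiple indices denote sums, e.g. $\alpha_{ij}=\alpha_i+\alpha_j$, $\beta_{ij}=\beta_i+\beta_j$. Further, $\alpha=\alpha_{45}-\alpha_{12}$, $\bar\alpha=\alpha_4-\alpha_{13}$, $\hat\alpha=\alpha_2-\alpha_{35}$, $\mathcal B_1=\beta_1\beta_5-\beta_2\beta_4$, and $$\mu_1=\frac{\hat\alpha\beta_{14}-\alpha\beta_3}{\beta_3\beta_{45}+\beta_5\beta_{14}},\qquad \mu_2=\frac{\bar\alpha\beta_{25}+\alpha\beta_3}{\beta_1\beta_{25}+\beta_3\beta_{12}}.$$ *)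

(* Defs.v *)
From HB Require Import structures.
From mathcomp Require Import all_boot all_order all_algebra.
From mathcomp Require Import boolp classical_sets reals.

Set Implicit Arguments.
Unset Strict Implicit.
Unset Printing Implicit Defensive.

Import Order.TTheory GRing.Theory Num.Theory.
Local Open Scope ring_scope.

Inductive node := node_a | node_b | node_c | node_d.

Definition node_to_nat (v : node) : nat :=
  match v with node_a => 0 | node_b => 1 | node_c => 2 | node_d => 3 end.

Lemma node_to_nat_inj : injective node_to_nat.
Proof. by move=> [] []. Qed.

HB.instance Definition _ := Equality.copy node (inj_type node_to_nat_inj).

Definition link : Type := (node * node)%type.

(* The position of a link in this list fixes the numbering 1, ..., 5 of the
   parameters alpha_i, beta_i. *)
Definition Nplus : seq link :=
  [:: (node_a, node_b); (node_b, node_d); (node_b, node_c);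
      (node_a, node_c); (node_c, node_d)].

Definition N : seq link := rem (node_b, node_c) Nplus.

Definition link_index (l : link) : nat := (index l Nplus).+1.

(* A path is the sequence of the nodes it visits. *)
Definition P1 : seq node := [:: node_a; node_b; node_d].
Definition P2 : seq node := [:: node_a; node_c; node_d].
Definition P3 : seq node := [:: node_a; node_b; node_c; node_d].

Definition links_of (p : seq node) : seq link := zip p (behead p).

(* The paths from a to d that only use links of the network E; this is
   [:: P1; P2; P3] for Nplus and [:: P1; P2] for N. *)
Definition paths (E : seq link) : seq (seq node) :=
  [seq p <- [:: P1; P2; P3] | all (mem E) (links_of p)].

Section Equilibrium.
Context {R : realType}.
(* Only the values of alpha and beta at 1, ..., 5 are used. *)
Variables alpha beta : nat -> R.

(* The values of a flow x outside (paths E) are irrelevant. *)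
Definition is_flow (E : seq link) (Q : R) (x : seq node -> R) : Prop :=
  (forall p, p \in paths E -> 0 <= x p) /\ \sum_(p <- paths E) x p = Q.

Definition link_flow (E : seq link) (x : seq node -> R) (l : link) : R :=
  \sum_(p <- paths E | l \in links_of p) x p.

Definition link_time (E : seq link) (x : seq node -> R) (l : link) : R :=
  alpha (link_index l) + beta (link_index l) * link_flow E x l.

Definition path_time (E : seq link) (x : seq node -> R) (p : seq node) : R :=
  \sum_(l <- links_of p) link_time E x l.

(* For Q > 0 some path has non-vanishing flow, so that T is determined
   by x. *)
Definition is_equilibrium (E : seq link) (Q : R) (x : seq node -> R) (T : R) :
    Prop :=
  is_flow E Q x /\
  forall p, p \in paths E ->
    (x p != 0 -> path_time E x p = T) /\ (x p = 0 -> T <= path_time E x p).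

Definition no_vanishing_path (E : seq link) (x : seq node -> R) : Prop :=
  forall p, p \in paths E -> x p != 0.

(* For E = N or Nplus, alpha_i >= 0, beta_i > 0 and Q > 0 the equilibrium exists
   and its path flows are unique: the set below is then a singleton and the
   default value 0 of xget plays no role. *)
Definition T_Eq (E : seq link) (Q : R) : R :=
  xget 0 [set T | exists x, is_equilibrium E Q x T]%classic.

Definition braess_paradox (Q : R) : Prop := T_Eq N Q < T_Eq Nplus Q.

Definition dalpha : R :=
  (alpha 4%N + alpha 5%N) - (alpha 1%N + alpha 2%N).
Definition alpha_bar : R := alpha 4%N - (alpha 1%N + alpha 3%N).
Definition alpha_hat : R := alpha 2%N - (alpha 3%N + alpha 5%N).

Definition bsum (i j : nat) : R := beta i + beta j.

Definition B1 : R := beta 1%N * beta 5%N - beta 2%N * beta 4%N.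

Definition mu1 : R :=
  (alpha_hat * bsum 1 4 - dalpha * beta 3%N)
  / (beta 3%N * bsum 4 5 + beta 5%N * bsum 1 4).

Definition mu2 : R :=
  (alpha_bar * bsum 2 5 + dalpha * beta 3%N)
  / (beta 1%N * bsum 2 5 + beta 3%N * bsum 1 2).

End Equilibrium.

(* Main.v *)
Require Import Defs.
From mathcomp Require Import all_boot all_order all_algebra.
From mathcomp Require Import boolp classical_sets reals.
From mathcomp Require Import ring lra.

(* Beckmann's variational inequality: two equilibria x, x' satisfy
   sum_l beta_l (f_l - f'_l)^2 <= 0, so they have the same link flows and hence
   the same travel time, and T_Eq can be read off the given equilibria.
   On N+ the equilibrium equations are linear in the path flows y1, y2, y3, and
     (beta_25 beta_14 + beta_3 beta_1245) y3
        = alpha_hat beta_14 + alpha_bar beta_25 - B1 Q,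
     beta_1245 (T+ - T) = B1 y3.
   Hence the paradox occurs iff B1 > 0; the bounds on Q express the positivity
   of the path flows of the two given equilibria. *)

Set Implicit Arguments.
Unset Strict Implicit.
Unset Printing Implicit Defensive.

Import Order.TTheory GRing.Theory Num.Theory.
Local Open Scope ring_scope.

Section Uniqueness.
Context {R : realType}.
Variables alpha beta : nat -> R.
Hypothesis hbeta : forall i : nat, (1 <= i <= 5)%N -> 0 < beta i.

(** Summing over the fixed list [Nplus] for every path makes the sums over paths and links
    exchangeable; no path uses a link twice. *)
Lemma path_timeE (E : seq link) (x : seq node -> R) (p : seq node) :
  p \in paths E ->
  path_time alpha beta E x p
  = \sum_(l <- Nplus | l \in links_of p) link_time alpha beta E x l.
Proof.
rewrite mem_filter !inE => /andP[_ /or3P[]/eqP->];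
  by rewrite /path_time unlock /= ?addr0.
Qed.

(** Double counting. The flow [x] that sets the times and the flow [y] that is charged are kept
    apart, so that one equilibrium can be priced at the times of another. *)
Lemma total_costE (E : seq link) (x y : seq node -> R) :
  \sum_(p <- paths E) path_time alpha beta E x p * y p
  = \sum_(l <- Nplus) link_time alpha beta E x l * link_flow E y l.
Proof.
under [RHS]eq_bigr do rewrite mulr_sumr.
rewrite (exchange_big_dep predT) //=; apply: eq_big_seq => p pE.
by rewrite path_timeE // mulr_suml.
Qed.

Lemma le_path_time (E : seq link) (Q T : R) (x : seq node -> R) (p : seq node) :
  is_equilibrium alpha beta E Q x T -> p \in paths E ->
  T <= path_time alpha beta E x p.
Proof.
case=> _ eqx /eqx[h1 h2].
by have [/h2 //|/h1->] := eqVneq (x p) 0.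
Qed.

Lemma equilibrium_cost (E : seq link) (Q T : R) (x : seq node -> R) :
  is_equilibrium alpha beta E Q x T ->
  \sum_(p <- paths E) path_time alpha beta E x p * x p = T * Q.
Proof.
case=> -[_ <-] eqx; rewrite mulr_sumr; apply: eq_big_seq => p /eqx[h1 _].
by have [->|/h1->//] := eqVneq (x p) 0; rewrite !mulr0.
Qed.

(** With the times frozen at [x], no path is faster than [T], so no flow of total [Q] costs less
    than [T * Q]. *)
Lemma equilibrium_cost_le (E : seq link) (Q T : R) (x y : seq node -> R) :
  is_equilibrium alpha beta E Q x T -> is_flow E Q y ->
  T * Q <= \sum_(p <- paths E) path_time alpha beta E x p * y p.
Proof.
move=> eqx [y0 <-]; rewrite mulr_sumr big_seq [leRHS]big_seq.
by apply: ler_sum => p pE; rewrite ler_wpM2r ?y0 ?(le_path_time eqx).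
Qed.

Lemma equilibrium_link_flow (E : seq link) (Q T T' : R) (x x' : seq node -> R) :
  is_equilibrium alpha beta E Q x T -> is_equilibrium alpha beta E Q x' T' ->
  {in Nplus, link_flow E x =1 link_flow E x'}.
Proof.
move=> eqx eqx'.
have bl l : l \in Nplus -> 0 < beta (link_index l).
  (* [link_index] is one more than the position, so being at most 5 is membership in [Nplus]. *)
  by move=> lN; rewrite hbeta //= -[5%N]/(size Nplus) index_mem.
have ge0 l : l \in Nplus ->
    0 <= beta (link_index l) * (link_flow E x l - link_flow E x' l) ^+ 2.
  by move=> /bl /ltW b0; rewrite mulr_ge0 // sqr_ge0.
have : \sum_(l <- Nplus)
    beta (link_index l) * (link_flow E x l - link_flow E x' l) ^+ 2 <= 0.
  have := equilibrium_cost_le eqx eqx'.1.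
  have := equilibrium_cost_le eqx' eqx.1.
  have := equilibrium_cost eqx; have := equilibrium_cost eqx'.
  rewrite !total_costE => <- <- le1 le2.
  (* Link times are affine with slope [beta], so each summand is the time difference multiplied by
     the flow difference; expanding it gives the four costs compared above. *)
  rewrite (eq_bigr (fun l => (link_time alpha beta E x l * link_flow E x l
      - link_time alpha beta E x l * link_flow E x' l)
    + (link_time alpha beta E x' l * link_flow E x' l
      - link_time alpha beta E x' l * link_flow E x l))); last first.
    by move=> l _; rewrite /link_time; ring.
  by rewrite big_split !sumrB /=; lra.
move=> le0 l lN.
have : \sum_(l <- Nplus)
    beta (link_index l) * (link_flow E x l - link_flow E x' l) ^+ 2 == 0.
  by rewrite eq_le le0 big_seq sumr_ge0.
rewrite big_seq psumr_eq0 // => /allP/(_ _ lN); rewrite lN /= mulf_eq0.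
by rewrite gt_eqF ?bl //= sqrf_eq0 subr_eq0 => /eqP.
Qed.

(** [T * Q] is at most the cost of [x'] at the times of [x]. Equal link flows make these the times
    of [x'], so this cost is [T' * Q]. *)
Lemma equilibrium_time_le (E : seq link) (Q T T' : R) (x x' : seq node -> R) :
  0 < Q -> is_equilibrium alpha beta E Q x T ->
  is_equilibrium alpha beta E Q x' T' -> T <= T'.
Proof.
move=> Q0 eqx eqx'; rewrite -(ler_pM2r Q0) -(equilibrium_cost eqx').
rewrite (le_trans (equilibrium_cost_le eqx eqx'.1)) // !total_costE.
rewrite le_eqVlt; apply/orP; left; apply/eqP/eq_big_seq => l lN.
by rewrite /link_time (equilibrium_link_flow eqx eqx').
Qed.

Lemma T_EqE (E : seq link) (Q T : R) (x : seq node -> R) :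
  0 < Q -> is_equilibrium alpha beta E Q x T -> T_Eq alpha beta E Q = T.
Proof.
move=> Q0 eqx; apply: xget_unique; first by exists x.
move=> T' [x' eqx']; apply/eqP.
by rewrite eq_le (equilibrium_time_le Q0 eqx' eqx) (equilibrium_time_le Q0 eqx eqx').
Qed.

End Uniqueness.

Section InteriorEquilibria.
Context {R : realType}.
Variables alpha beta : nat -> R.

Lemma interior_equilibriumN (Q T : R) (x : seq node -> R) :
  is_equilibrium alpha beta N Q x T -> no_vanishing_path N x ->
  [/\ 0 < x P1, 0 < x P2, x P1 + x P2 = Q,
      T = alpha 1%N + beta 1%N * x P1 + (alpha 2%N + beta 2%N * x P1) &
      T = alpha 4%N + beta 4%N * x P2 + (alpha 5%N + beta 5%N * x P2)].
Proof.
case=> -[x0 sx] eqx nx.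
have gt0 p : p \in paths N -> 0 < x p by move=> pN; rewrite lt0r nx ?x0.
have eqT p : p \in paths N -> path_time alpha beta N x p = T.
  by move=> pN; apply: (eqx p pN).1; exact: nx.
split; rewrite ?gt0 //.
- by rewrite -sx unlock /= addr0.
- by rewrite -(eqT P1) // /path_time /link_time /link_flow unlock /= !addr0.
- by rewrite -(eqT P2) // /path_time /link_time /link_flow unlock /= !addr0.
Qed.

Lemma interior_equilibriumNplus (Q T : R) (y : seq node -> R) :
  is_equilibrium alpha beta Nplus Q y T -> no_vanishing_path Nplus y ->
  [/\ [/\ 0 < y P1, 0 < y P2 & 0 < y P3], y P1 + y P2 + y P3 = Q,
      T = alpha 1%N + beta 1%N * (y P1 + y P3) + (alpha 2%N + beta 2%N * y P1),
      T = alpha 4%N + beta 4%N * y P2 + (alpha 5%N + beta 5%N * (y P2 + y P3)) &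
      T = alpha 1%N + beta 1%N * (y P1 + y P3) + (alpha 3%N + beta 3%N * y P3)
          + (alpha 5%N + beta 5%N * (y P2 + y P3))].
Proof.
case=> -[y0 sy] eqy ny.
have gt0 p : p \in paths Nplus -> 0 < y p by move=> pN; rewrite lt0r ny ?y0.
have eqT p : p \in paths Nplus -> path_time alpha beta Nplus y p = T.
  by move=> pN; apply: (eqy p pN).1; exact: ny.
split; first by split; rewrite gt0.
- by rewrite -sy unlock /= addr0 addrA.
- by rewrite -(eqT P1) // /path_time /link_time /link_flow unlock /= !addr0.
- by rewrite -(eqT P2) // /path_time /link_time /link_flow unlock /= !addr0.
- by rewrite -(eqT P3) // /path_time /link_time /link_flow unlock /= !addr0 addrA.
Qed.

End InteriorEquilibria.

Theorem theorem1 (R : realType) (alpha beta : nat -> R) (Q : R)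
  (halpha : forall i : nat, (1 <= i <= 5)%N -> 0 <= alpha i)
  (hbeta : forall i : nat, (1 <= i <= 5)%N -> 0 < beta i)
  (hQ : 0 < Q)
  (hN : exists (x : seq node -> R) (T : R),
      is_equilibrium alpha beta N Q x T /\ no_vanishing_path N x)
  (hNplus : exists (x : seq node -> R) (T : R),
      is_equilibrium alpha beta Nplus Q x T /\ no_vanishing_path Nplus x) :
  braess_paradox alpha beta Q <->
  0 < B1 beta /\
  Num.max
    (Num.max (dalpha alpha / bsum beta 1 2) (- dalpha alpha / bsum beta 4 5))
    (Num.max (mu1 alpha beta) (mu2 alpha beta)) < Q /\
  Q < (alpha_hat alpha * bsum beta 1 4 + alpha_bar alpha * bsum beta 2 5)
      / B1 beta.
Proof.
have [x [T [eqx nx]]] := hN; have [y [T' [eqy ny]]] := hNplus.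
rewrite /braess_paradox (T_EqE hbeta hQ eqx) (T_EqE hbeta hQ eqy).
have [x1 x2 sx Tx1 Tx2] := interior_equilibriumN eqx nx.
have [[y1 y2 y3] sy Ty1 Ty2 Ty3] := interior_equilibriumNplus eqy ny.
have [b1 b2 b3 b4 b5] : [/\ 0 < beta 1%N, 0 < beta 2%N, 0 < beta 3%N,
    0 < beta 4%N & 0 < beta 5%N] by split; apply: hbeta.
rewrite !gt_max /mu1 /mu2 /B1 /bsum /dalpha /alpha_bar /alpha_hat.
move: (alpha 1%N) (alpha 2%N) (alpha 3%N) (alpha 4%N) (alpha 5%N)
  (beta 1%N) (beta 2%N) (beta 3%N) (beta 4%N) (beta 5%N)
  (x P1) (x P2) (y P1) (y P2) (y P3) => a1 a2 a3 a4 a5 c1 c2 c3 c4 c5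
  X1 X2 Y1 Y2 Y3 in x1 x2 sx Tx1 Tx2 y1 y2 y3 sy Ty1 Ty2 Ty3 b1 b2 b3 b4 b5 *.
(* The equilibrium equations solved for the alphas: P1 against P2 on [N], then P1 against P3 and P2
   against P3 on [Nplus]. Substituting them leaves polynomial identities for [ring]. *)
have a45E : a4 + a5 = a1 + c1 * X1 + (a2 + c2 * X1) - c4 * X2 - c5 * X2 by lra.
have a2E : a2 = a3 + c3 * Y3 + (a5 + c5 * (Y2 + Y3)) - c2 * Y1 by lra.
have a4E : a4 = a1 + c1 * (Y1 + Y3) + (a3 + c3 * Y3) - c4 * Y2 by lra.
have dT : (c1 + c2 + (c4 + c5)) * (T' - T) = (c1 * c5 - c2 * c4) * Y3.
  (* The change of travel time seen along P1, then along P2. Weighting these by [c4 + c5] and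
     [c1 + c2] leaves only [Y3], by conservation of the total flow. *)
  have d1 : T' - T = (c1 + c2) * (Y1 - X1) + c1 * Y3 by lra.
  have d2 : T' - T = (c4 + c5) * (Y2 - X2) + c5 * Y3 by lra.
  rewrite mulrDl {1}d2 d1.
  have -> : X1 = Y1 + Y2 + Y3 - X2 by lra.
  by ring.
have S0 : 0 < c1 + c2 + (c4 + c5) by lra.
have D0 : 0 < (c1 + c4) * (c2 + c5) + c3 * (c1 + c2 + (c4 + c5)).
  by rewrite addr_gt0 // mulr_gt0 // addr_gt0.
have -> : (T < T') = (0 < c1 * c5 - c2 * c4).
  by rewrite -subr_gt0 -(pmulr_rgt0 _ S0) dT pmulr_lgt0.
(* The paradox is now the sign condition itself, so only the bounds on [Q] remain to be derived. The
   upper one is [0 < Y3], scaled by the quantity of [D0]. *)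
split=> [B0|[]//]; split=> //; split; last first.
  rewrite ltr_pdivlMr // -subr_gt0.
  suff -> : (a2 - (a3 + a5)) * (c1 + c4) + (a4 - (a1 + a3)) * (c2 + c5)
      - Q * (c1 * c5 - c2 * c4)
    = ((c1 + c4) * (c2 + c5) + c3 * (c1 + c2 + (c4 + c5))) * Y3.
    exact: mulr_gt0.
  by rewrite a2E a4E -sy; ring.
(* Cleared of denominators, the four lower bounds are in turn the positivity of [X2], [X1], [Y1] and
   [Y2], each scaled by the positive quantity of [S0] or [D0]. *)
apply/andP; split; apply/andP; split;
  rewrite ltr_pdivrMr ?addr_gt0 ?mulr_gt0 ?addr_gt0 // -subr_gt0.
- suff -> : Q * (c1 + c2) - (a4 + a5 - (a1 + a2))
    = (c1 + c2 + (c4 + c5)) * X2 by exact: mulr_gt0.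
  by rewrite a45E -sx; ring.
- suff -> : Q * (c4 + c5) - - (a4 + a5 - (a1 + a2))
    = (c1 + c2 + (c4 + c5)) * X1 by exact: mulr_gt0.
  by rewrite a45E -sx; ring.
- set num := (X in _ - X); set den := (X in Q * X).
  suff -> : Q * den - num
    = ((c1 + c4) * (c2 + c5) + c3 * (c1 + c2 + (c4 + c5))) * Y1.
    exact: mulr_gt0.
  by rewrite /num /den a2E a4E -sy; ring.
- set num := (X in _ - X); set den := (X in Q * X).
  suff -> : Q * den - num
    = ((c1 + c4) * (c2 + c5) + c3 * (c1 + c2 + (c4 + c5))) * Y2.
    exact: mulr_gt0.
  by rewrite /num /den a2E a4E -sy; ring.
Qed.
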